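(* Let $W=(U,A_0,L,A_1,Y)$ be random variables whose joint distribution is faithful to one of the four directed acyclic graphs DAG 1a, DAG 1b, DAG 1c, DAG 1d defined in the context. Then the null hypothesis $(A_0,A_1)\perp\!\!\!\perp Y\mid (L,U)$ holds if and only if both of the following hold: (i) $Y\perp\!\!\!\perp A_1\mid (A_0,L)$, i.e. $f(y\mid \ell,a_0,a_1)=f(y\mid \ell,a_0)$; and (ii) $\sum_{\ell=0}^{1} f(y\mid a_0,\ell)\,f(\ell\mid a_0)$ does not depend on $a_0$.
   Context: Variables: $A_0,A_1,Y$ are continuous real random variables, $L$ is binary with values in $\{0,1\}$, and $U$ is a hidden (unobserved) real random variable. The joint distribution has a density with respect to a product of Lebesgue measures (for continuous components) and counting measures (for discrete components); $f(\cdot\mid\cdot)$ denotes the corresponding conditional densities. Identities between conditional densities, and ''does not depend on $a_0$'', are understood up to null sets. Graphs on the vertex set $\{U,A_0,L,A_1,Y\}$: - DAG 1a has exactly the arrows $A_0\to L$, $A_0\to A_1$, $A_0\to Y$, $U\to L$, $U\to Y$, $L\to A_1$, $A_1\to Y$. - DAG 1b is DAG 1a with the arrows $A_0\to Y$ and $A_1\to Y$ removed. - DAG 1c is DAG 1a with the arrow $A_0\to Y$ removed. - DAG 1d is DAG 1a with the arrow $A_1\to Y$ removed. Faithfulness: the distribution of $W$ is faithful to a DAG $G$ on these vertices if for all disjoint (possibly empty) subsets $B,C,D$ of the variables in $W$, $B\perp\!\!\!\perp C\mid D$ if and only if $B$ is d-separated from $C$ given $D$ in $G$. *)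

(* Defs.v *)
From HB Require Import structures.
From mathcomp Require Import all_boot all_order all_algebra.
From mathcomp Require Import all_classical all_reals all_analysis.

Set Implicit Arguments.
Unset Strict Implicit.
Unset Printing Implicit Defensive.

Import Order.TTheory GRing.Theory Num.Theory.
Import numFieldNormedType.Exports.

Local Open Scope ring_scope.
Local Open Scope classical_set_scope.

Inductive vertex := VU | VA0 | VL | VA1 | VY.

Definition nat_of_vertex (v : vertex) : nat :=
  match v with VU => 0 | VA0 => 1 | VL => 2 | VA1 => 3 | VY => 4 end.

Definition vertex_of_nat (n : nat) : vertex :=
  match n with 0 => VU | 1 => VA0 | 2 => VL | 3 => VA1 | _ => VY end.

Lemma nat_of_vertexK : cancel nat_of_vertex vertex_of_nat.
Proof. by case. Qed.

HB.instance Definition _ := Countable.copy vertex (can_type nat_of_vertexK).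

Lemma vertex_enumP : Finite.axiom [:: VU; VA0; VL; VA1; VY].
Proof. by case. Qed.

HB.instance Definition _ := fintype.isFinite.Build vertex vertex_enumP.

Definition edges_1a : seq (vertex * vertex) :=
  [:: (VA0, VL); (VA0, VA1); (VA0, VY); (VU, VL); (VU, VY); (VL, VA1);
      (VA1, VY)].

Definition dag_1a : rel vertex := fun x y => (x, y) \in edges_1a.

Definition dag_1b : rel vertex :=
  fun x y => dag_1a x y && ((x, y) \notin [:: (VA0, VY); (VA1, VY)]).

Definition dag_1c : rel vertex :=
  fun x y => dag_1a x y && ((x, y) != (VA0, VY)).

Definition dag_1d : rel vertex :=
  fun x y => dag_1a x y && ((x, y) != (VA1, VY)).

Section DSeparation.
Variables (V : finType) (e : rel V).

Definition adjacent : rel V := fun x y => e x y || e y x.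

(* The status of the middle vertex y of a stretch x - y - z of a path, given D.
   [connect] is reflexive: y counts as a descendant of itself. *)
Definition open_at (D : {set V}) (x y z : V) : bool :=
  if e x y && e z y then [exists d in D, connect e y d] else y \notin D.

Fixpoint open_path (D : {set V}) (s : seq V) : bool :=
  match s with
  | x :: ((y :: z :: _) as s') => open_at D x y z && open_path D s'
  | _ => true
  end.

Definition d_separated (B C D : {set V}) : Prop :=
  forall (x : V) (s : seq V), x \in B -> last x s \in C ->
    path adjacent x s -> uniq (x :: s) -> ~~ open_path D (x :: s).

End DSeparation.

(* Values of (U, A0, L, A1, Y), with false and true standing for the values 0
   and 1 of L. *)
Notation config R :=
  (measurableTypeR R * measurableTypeR R * bool * measurableTypeR R *
   measurableTypeR R)%type.

Section Densities.
Context {R : realType}.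

Definition val_Y (w : config R) : R := let: (_, _, _, _, y) := w in y.

Definition set_L (w : config R) (l : bool) : config R :=
  let: (u, a0, _, a1, y) := w in (u, a0, l, a1, y).

Lemma sigma_finite_counting_bool :
  sigma_finite [set: bool] (@counting bool R).
Proof.
exists (fun=> setT); first by rewrite bigcup_const//; exists 0%N.
move=> n; split => //; rewrite /counting asboolT ?ltry//; exact: finite_finset.
Qed.

HB.instance Definition _ := Measure_isSigmaFinite.Build _ _ _
  (@counting bool R) sigma_finite_counting_bool.

(* The factor of the dominating measure for U: Lebesgue measure if U is
   continuous, counting measure on a countable set of reals if U is discrete. *)
Definition lebesgue_or_counting (muU : set R -> \bar R) : Prop :=
  (forall E : set R, measurable E -> muU E = lebesgue_measure E) \/
  (exists2 K : set R, countable K &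
    forall E : set R, measurable E -> muU E = counting (E `&` K)).

Section Base.
Variable muU : {sigma_finite_measure set (measurableTypeR R) -> \bar R}.

Definition base_measure :=
  (muU \x @lebesgue_measure R \x @counting bool R
       \x @lebesgue_measure R \x @lebesgue_measure R)%E.

HB.instance Definition _ := Measure.on base_measure.

Definition integrate_out (v : vertex) (g : config R -> \bar R) :
    config R -> \bar R :=
  fun w => let: (u, a0, l, a1, y) := w in
  match v with
  | VU => \int[muU]_t g (t, a0, l, a1, y)
  | VA0 => \int[@lebesgue_measure R]_t g (u, t, l, a1, y)
  | VL => \int[@counting bool R]_t g (u, a0, t, a1, y)
  | VA1 => \int[@lebesgue_measure R]_t g (u, a0, l, t, y)
  | VY => \int[@lebesgue_measure R]_t g (u, a0, l, a1, t)
  end%E.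

(* The density of the subvector with index set S, as a function of the whole
   configuration that is constant in the coordinates outside S. *)
Definition marginal (f : config R -> R) (S : {set vertex}) :
    config R -> \bar R :=
  foldr integrate_out (EFin \o f) (enum (~: S)).

(* f(b | d), with value 0 where f(d) vanishes. *)
Definition cond_density (f : config R -> R) (B D : {set vertex}) (w : config R) :
    R :=
  fine (marginal f (B :|: D) w) / fine (marginal f D w).

(* f(b | c, d) = f(b | d) up to null sets, wherever f(b | c, d) is defined. *)
Definition cond_indep (f : config R -> R) (B C D : {set vertex}) : Prop :=
  {ae base_measure, forall w, (0 < marginal f (C :|: D) w)%E ->
    cond_density f B (C :|: D) w = cond_density f B D w}.

Definition faithful (f : config R -> R) (e : rel vertex) : Prop :=
  forall B C D : {set vertex},
    [disjoint B & C]%B -> [disjoint B & D]%B -> [disjoint C & D]%B ->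
    cond_indep f B C D <-> d_separated e B C D.

Definition g_formula (f : config R -> R) (w : config R) : R :=
  \sum_(l : bool)
    cond_density f [set VY]%SET [set VA0; VL]%SET (set_L w l) *
    cond_density f [set VL]%SET [set VA0]%SET (set_L w l).

(* On f(a0) > 0, where the conditional densities given a0 are defined, the sum
   agrees almost everywhere with a function of y alone. *)
Definition g_formula_free_of_A0 (f : config R -> R) : Prop :=
  exists h : R -> R,
    {ae base_measure, forall w, (0 < marginal f [set VA0]%SET w)%E ->
      g_formula f w = h (val_Y w)}.

Definition joint_density d (Omega : measurableType d) (P : probability Omega R)
    (U A0 : Omega -> R) (L : Omega -> bool) (A1 Y : Omega -> R)
    (f : config R -> R) : Prop :=
  [/\ measurable_fun setT f, forall w, 0 <= f w &
    forall E : set (config R), measurable E ->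
      P ((fun o => (U o, A0 o, L o, A1 o, Y o)) @^-1` E) =
        (\int[base_measure]_(w in E) (f w)%:E)%E].

End Base.
End Densities.

(* Main.v *)
From HB Require Import structures.
Require Import Defs.
From mathcomp Require Import all_boot all_order all_algebra.
From mathcomp Require Import all_classical all_reals all_analysis.
From mathcomp Require Import measurable_realfun.

(* The sum in (ii) is the conditional density f(y | a0): the factors f(l | a0)
   cancel the conditioning on l, and f(y, a0, l) vanishes almost everywhere
   where f(a0, l) does.  Hence (ii) says that Y and A0 are marginally
   independent, so that by faithfulness all three conditions are d-separation
   statements.  In DAG 1b all of them hold: every path from A0 or A1 to Y ends in
   L <- U -> Y and is blocked at U for the null hypothesis, at L or A0 for (i),
   and at a collider (L or A1) for (ii).  In DAGs 1a and 1c the edge A1 -> Y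
   refutes the null hypothesis and (i); in DAG 1d the edge A0 -> Y refutes the
   null hypothesis and (ii). *)

Set Implicit Arguments.
Unset Strict Implicit.
Unset Printing Implicit Defensive.

Import Order.TTheory GRing.Theory Num.Theory.

Local Open Scope ring_scope.
Local Open Scope classical_set_scope.

(** * D-separation in the four graphs *)

(** A path made of a single edge has no middle vertex, so no conditioning set can block it. *)
Lemma edge_not_d_separated (V : finType) (e : rel V) (B C D : {set V}) x y :
  x \in B -> y \in C -> x != y -> Defs.adjacent e x y -> ~ d_separated e B C D.
Proof.
move=> xB yC xy exy /(_ x [:: y] xB yC); rewrite /= exy inE xy.
by move=> /(_ isT isT).
Qed.

(** Splits the path vertex by vertex. Distinctness of the vertices bounds its length by five, which
    ends the recursion. *)
Ltac enumerate_paths :=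
  match goal with
  | s : seq _ |- _ =>
      case: s => [|[] s]; rewrite /= ?inE ?eqxx ?andbF ?andbT //=; enumerate_paths
  | _ => idtac
  end.

Ltac decide_d_separation :=
  let x := fresh "x" in let s := fresh "s" in
  move=> x s; case: x; rewrite !inE //= => _; enumerate_paths;
  move=> _ _ _; rewrite /open_at /dag_1b /dag_1a /= ?inE ?andbF //=.

Lemma d_separated_1b_null :
  d_separated dag_1b [set VA0; VA1]%SET [set VY]%SET [set VL; VU]%SET.
Proof. decide_d_separation. Qed.

Lemma d_separated_1b_Y_A1 :
  d_separated dag_1b [set VY]%SET [set VA1]%SET [set VA0; VL]%SET.
Proof. decide_d_separation. Qed.

Lemma d_separated_1b_Y_A0 :
  d_separated dag_1b [set VY]%SET [set VA0]%SET (@finset.set0 vertex).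
Proof.
(* What remains are the paths with a collider, which would be open only if some descendant lay in
   the empty set. *)
by decide_d_separation; apply/existsP => -[d]; rewrite inE.
Qed.

(** * Almost everywhere statements on a product *)

Section AeProduct.
Context d1 d2 (T1 : measurableType d1) (T2 : measurableType d2) (R : realType).
Variable m1 : {sigma_finite_measure set T1 -> \bar R}.
Variable m2 : {sigma_finite_measure set T2 -> \bar R}.
Implicit Types (N : set (T1 * T2)) (Q : T1 * T2 -> Prop).

Lemma product_sigma_finite : sigma_finite setT (m1 \x m2)%E.
Proof.
by case: (lebesgue_integral_fubini.measure_function_Measure_isSigmaFinite__to__measure_function_isSigmaFinite
  m1 m2).
Qed.

(* Explicit, because unification only tries the library's instance for products
   of subprobabilities. *)
Definition sigma_finite_product :
    {sigma_finite_measure set (T1 * T2)%type -> \bar R} :=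
  HB.pack (m1 \x m2)%E
    (@Measure_isSigmaFinite.Build _ _ _ (m1 \x m2)%E product_sigma_finite).

(** The product measure is defined through [xsection]; Tonelli's theorem for the indicator of [N]
    exchanges the two factors. *)
Lemma product_measure_sections N : measurable N ->
  (m1 \x m2)%E N = (\int[m2]_y m1 (ysection N y))%E.
Proof.
move=> mN; rewrite -[LHS]/(\int[m1]_x (m2 \o xsection N) x)%E.
rewrite -[RHS]/(\int[m2]_y (m1 \o ysection N) y)%E.
by rewrite -(indic_fubini_tonelli_FE m2 mN) -(indic_fubini_tonelli_GE m1 mN)
  indic_fubini_tonelli.
Qed.

(** A non-negative function, here the measure of the section, has integral zero exactly when it
    vanishes almost everywhere. *)
Lemma product_null_xsection N : measurable N ->
  (m1 \x m2)%E N = 0%E <-> {ae m1, forall x, m2 (xsection N x) = 0%E}.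
Proof.
move=> mN; have := ae_eq_integral_abs m1 measurableT (measurable_fun_xsection m2 mN).
under eq_integral do rewrite gee0_abs//.
case=> H1 H2; split=> [/H1|H].
  by apply: filterS => x /(_ Logic.I).
by apply: H2; apply: filterS H => x.
Qed.

Lemma product_null_ysection N : measurable N ->
  (m1 \x m2)%E N = 0%E <-> {ae m2, forall y, m1 (ysection N y) = 0%E}.
Proof.
move=> mN; rewrite product_measure_sections//.
have := ae_eq_integral_abs m2 measurableT (measurable_fun_ysection m1 mN).
under eq_integral do rewrite gee0_abs//.
case=> H1 H2; split=> [/H1|H].
  by apply: filterS => x /(_ Logic.I).
by apply: H2; apply: filterS H => x.
Qed.

Lemma ae_product_xsection Q : {ae (m1 \x m2)%E, forall z, Q z} ->
  {ae m1, forall x, {ae m2, forall y, Q (x, y)}}.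
Proof.
move=> [N [mN N0 QN]]; move/(product_null_xsection mN) : N0.
apply: filterS => x Nx0; exists (xsection N x); split => //.
  exact: measurable_xsection.
by move=> y /= nQ; rewrite /xsection/= inE; exact: QN.
Qed.

Lemma ae_product_ysection Q : {ae (m1 \x m2)%E, forall z, Q z} ->
  {ae m2, forall y, {ae m1, forall x, Q (x, y)}}.
Proof.
move=> [N [mN N0 QN]]; move/(product_null_ysection mN) : N0.
apply: filterS => y Ny0; exists (ysection N y); split => //.
  exact: measurable_ysection.
by move=> x /= nQ; rewrite /ysection/= inE; exact: QN.
Qed.

(** Measurability lets the failure set of [Q] itself serve as the exceptional set, null because its
    sections are. *)
Lemma xsection_ae_product Q : measurable [set z | Q z] ->
  {ae m1, forall x, {ae m2, forall y, Q (x, y)}} ->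
  {ae (m1 \x m2)%E, forall z, Q z}.
Proof.
move=> /measurableC mQ H; exists (~` [set z | Q z]); split => //.
apply/product_null_xsection => //; apply: filterS H => x Qx.
apply: measure_negligible; first exact: measurable_xsection.
by apply: negligibleS Qx => y; rewrite /xsection/= inE.
Qed.

Lemma ysection_ae_product Q : measurable [set z | Q z] ->
  {ae m2, forall y, {ae m1, forall x, Q (x, y)}} ->
  {ae (m1 \x m2)%E, forall z, Q z}.
Proof.
move=> /measurableC mQ H; exists (~` [set z | Q z]); split => //.
apply/product_null_ysection => //; apply: filterS H => y Qy.
apply: measure_negligible; first exact: measurable_ysection.
by apply: negligibleS Qy => x; rewrite /ysection/= inE.
Qed.

(** The cylinder over a null set is null even if the other factor has infinite mass, by the
    convention [0 * +oo = 0]. *)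
Lemma ae_product_fst (Q : T1 -> Prop) : {ae m1, forall x, Q x} ->
  {ae (m1 \x m2)%E, forall z, Q z.1}.
Proof.
move=> [N [mN N0 QN]]; exists (N `*` setT); split.
- exact: measurableX.
- by rewrite product_measure1E// [X in (X * _)%E]N0 mul0e.
- by move=> [x y] /= /QN.
Qed.

Lemma ae_product_snd (Q : T2 -> Prop) : {ae m2, forall y, Q y} ->
  {ae (m1 \x m2)%E, forall z, Q z.2}.
Proof.
move=> [N [mN N0 QN]]; exists (setT `*` N); split.
- exact: measurableX.
- by rewrite product_measure1E// [X in (_ * X)%E]N0 mule0.
- by move=> [x y] /= /QN.
Qed.

End AeProduct.

(** Serves to freeze coordinates on which a statement does not depend: a property that fails
    everywhere would make the whole space null. *)
Lemma ae_witness d (T : measurableType d) (R : realType)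
    (m : {measure set T -> \bar R}) (Q : T -> Prop) :
  m setT != 0%E -> {ae m, forall x, Q x} -> exists x, Q x.
Proof.
move=> m0 [N [mN N0 QN]]; apply: contrapT => /forallNP nQ.
have NT : N = setT by apply/seteqP; split=> // x _; exact/QN/nQ.
by move/eqP: m0; apply; rewrite -NT.
Qed.

Lemma integral_counting_bool (R : realType) (g : bool -> \bar R) :
  (forall b, 0 <= g b)%E ->
  (\int[@counting bool R]_b g b = g true + g false)%E.
Proof.
move=> g0; have mg D : measurable_fun D g by [].
rewrite (_ : setT = [set true] `|` [set false]); last first.
  by apply/seteqP; split => // -[] _; [left|right].
have int1 b : (\int[@counting bool R]_(x in [set b]) g x = g b)%E.
  rewrite (eq_integral (cst (g b))) => [|x /[!inE] -> //].
  rewrite integral_cst//= /counting asboolT; last exact: finite_set1.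
  by rewrite fset_set1 finmap.cardfs1 mule1.
rewrite ge0_integral_setU ?int1//.
by apply/disj_set2P/seteqP; split => // b [/= ->].
Qed.

(** * Joint densities of two variables: null sets, finiteness, factorization *)

Section TwoVariables.
Context d1 d2 (T1 : measurableType d1) (T2 : measurableType d2) (R : realType).
Variable m1 : {sigma_finite_measure set T1 -> \bar R}.
Variable m2 : {sigma_finite_measure set T2 -> \bar R}.
Local Open Scope ereal_scope.

(** On each section a non-negative function of integral zero vanishes almost everywhere. This
    controls the points where a conditional density divides by zero. *)
Lemma ae_eq0_of_marginal_eq0 (p : T1 * T2 -> \bar R) :
  measurable_fun setT p -> (forall z, 0 <= p z) ->
  {ae (m1 \x m2), forall z, \int[m2]_y p (z.1, y) = 0 -> p z = 0}.
Proof.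
move=> mp p0; have mq := @measurable_fun_fubini_tonelli_F _ _ _ _ _ m2 p mp p0.
apply: xsection_ae_product.
  rewrite (_ : [set z | _] = ~` [set z | fubini_F m2 p z.1 = 0]
      `|` [set z | p z = 0]); last first.
    apply/seteqP; split => z /=; last by case.
    by have [Hz|] := eqVneq (fubini_F m2 p z.1) 0; [right; auto|move/eqP; left].
  apply: measurableU.
    apply: measurableC; rewrite -[X in measurable X]setTI.
    by apply: measurable_eqe => //; apply: measurableT_comp.
  by rewrite -[X in measurable X]setTI; apply: measurable_eqe.
apply: aeW => x /=.
have mpx : measurable_fun setT (fun y => p (x, y)) by exact: measurable_fun_pair2.
have [q0|q0] := pselect (\int[m2]_y p (x, y) = 0); last exact: aeW.
have /(ae_eq_integral_abs m2 measurableT mpx) :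
    \int[m2]_y `|p (x, y)| = 0.
  by under eq_integral do rewrite gee0_abs//.
by apply: filterS => y /(_ Logic.I).
Qed.

Lemma ae_lty_of_integral d (T : measurableType d)
    (m : {measure set T -> \bar R}) (g : T -> \bar R) :
  measurable_fun setT g -> (forall x, 0 <= g x) ->
  \int[m]_x g x < +oo -> {ae m, forall x, g x < +oo}.
Proof.
move=> mg g0 gi; have : m.-integrable setT g.
  apply/integrableP; split => //.
  by under eq_integral do rewrite gee0_abs//.
move/integrable_ae => /(_ measurableT); apply: filterS => x /(_ Logic.I).
by rewrite ge0_fin_numE.
Qed.

(** [r] is a joint probability density, with marginal densities [s] and [t]. *)
Variable r : T1 * T2 -> \bar R.
Hypotheses (mr : measurable_fun setT r) (r0 : forall z, 0 <= r z).
Hypothesis r1 : \int[m1]_x \int[m2]_y r (x, y) = 1.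
Let s x := \int[m2]_y r (x, y).
Let t y := \int[m1]_x r (x, y).

Lemma ae_density_lty : {ae (m1 \x m2), forall z, r z < +oo}.
Proof.
by apply: ae_lty_of_integral => //; rewrite fubini_tonelli1// /fubini_F r1 ltry.
Qed.

Lemma ae_marginal1_lty : {ae m1, forall x, s x < +oo}.
Proof.
apply: ae_lty_of_integral.
- exact: (@measurable_fun_fubini_tonelli_F _ _ _ _ _ m2).
- by move=> x; exact: integral_ge0.
- by rewrite /s r1 ltry.
Qed.

Lemma ae_marginal2_lty : {ae m2, forall y, t y < +oo}.
Proof.
apply: ae_lty_of_integral.
- exact: (@measurable_fun_fubini_tonelli_G _ _ _ _ _ m1).
- by move=> x; exact: integral_ge0.
- by rewrite /t -fubini_tonelli// r1 ltry.
Qed.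

(* No measurability of h is needed: for fixed y, integrating r(x, y) = |h y| s(x)
   in x identifies |h y| as t y. *)
Lemma density_factorization (h : T2 -> R) :
  {ae m2, forall y, {ae m1, forall x, 0 < s x ->
    (fine (r (x, y)) / fine (s x))%R = h y}} ->
  {ae (m1 \x m2), forall z, r z = s z.1 * t z.2}.
Proof.
move=> hE; apply: ysection_ae_product.
  rewrite -[X in measurable X]setTI; apply: measurable_eqe => //.
  apply: emeasurable_funM; apply: measurableT_comp => //.
    exact: (@measurable_fun_fubini_tonelli_F _ _ _ _ _ m2).
  exact: (@measurable_fun_fubini_tonelli_G _ _ _ _ _ m1).
have := ae_product_ysection (ae_eq0_of_marginal_eq0 mr r0).
have := ae_product_ysection ae_density_lty.
apply: filterS3 hE => y hy ry ry0.
(* Where [s x > 0] the quotient is non-negative, so [h y] equals its absolute value; where [s x = 0]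
   both sides vanish. The absolute value keeps the constant non-negative for the integration in
   [x]. *)
have rE : {ae m1, forall x, r (x, y) = `|h y|%:E * s x}.
  have := ae_marginal1_lty; apply: filterS2; last first.
    exact: (filterI hy (filterI ry ry0)).
  move=> x [hx [rx rx0]] sx.
  have := integral_ge0 => /(_ _ _ _ m2 setT (fun y => r (x, y)) (fun _ _ => r0 _)).
  rewrite -/(s x) le_eqVlt => /orP[/eqP sx0|sx0].
    by rewrite -sx0 mule0 rx0.
  have rf : r (x, y) \is a fin_num by rewrite ge0_fin_numE.
  have sf : s x \is a fin_num by rewrite ge0_fin_numE// ltW.
  have s1 : (0 < fine (s x))%R by rewrite fine_gt0// sx0.
  have r2 : (0 <= fine (r (x, y)))%R by rewrite fine_ge0.
  rewrite -(hx sx0) ger0_norm ?divr_ge0 ?(ltW s1)//.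
  by rewrite -[X in _ * X](fineK sf) -EFinM divfK ?gt_eqF// fineK.
have tE : t y = `|h y|%:E.
  rewrite /t (ge0_ae_eq_integral (g := fun x => `|h y|%:E * s x))//.
  - rewrite ge0_integralZl ?r1 ?mule1//.
    + exact: (@measurable_fun_fubini_tonelli_F _ _ _ _ _ m2).
    + by move=> x _; exact: integral_ge0.
  - exact: measurable_fun_pair1.
  - apply: emeasurable_funM => //.
    exact: (@measurable_fun_fubini_tonelli_F _ _ _ _ _ m2).
  - by move=> x _; rewrite mule_ge0// integral_ge0.
  - by apply: filterS rE => x + _.
by apply: filterS rE => x; rewrite tE muleC.
Qed.

End TwoVariables.

(** * Marginal densities *)

Ltac measurable_tuple :=
  lazymatch goal with
  | |- measurable_fun _ (fun z => (_, _)) =>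
      apply: measurable_fun_pair; measurable_tuple
  | |- measurable_fun _ (fun z => z) => exact: measurable_id
  | |- measurable_fun _ (fun z => fst _) =>
      apply: (measurableT_comp measurable_fst); measurable_tuple
  | |- measurable_fun _ (fun z => snd _) =>
      apply: (measurableT_comp measurable_snd); measurable_tuple
  | |- measurable_fun _ fst => exact: measurable_fst
  | |- measurable_fun _ snd => exact: measurable_snd
  | |- _ => exact: measurable_cst
  end.

Section IntegrateOut.
Context (R : realType).
Variable muU : {sigma_finite_measure set (measurableTypeR R) -> \bar R}.
Implicit Types (g : config R -> \bar R) (v : vertex) (S : {set vertex}).
Let lambda : {sigma_finite_measure set (measurableTypeR R) -> \bar R} :=
  @lebesgue_measure R.

Lemma integrate_out_ge0 v g : (forall w, 0 <= g w)%E ->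
  (forall w, 0 <= integrate_out muU v g w)%E.
Proof.
by move=> g0 [[[[u a0] l] a1] y]; case: v; apply: integral_ge0 => t _; exact: g0.
Qed.

Lemma measurable_integrate_out v g : measurable_fun setT g ->
  (forall w, 0 <= g w)%E -> measurable_fun setT (integrate_out muU v g).
Proof.
move=> mg g0.
(* [c] inserts the integration variable into its coordinate, so that all five cases become one
   statement about integrals over sections. *)
have aux d (T : measurableType d) (mu : {sigma_finite_measure set T -> \bar R})
    (c : config R * T -> config R) : measurable_fun setT c ->
    measurable_fun setT (fun w => \int[mu]_t g (c (w, t)))%E.
  move=> mc; apply: (@measurable_fun_fubini_tonelli_F _ _ _ _ R mu (g \o c)).
    exact: measurableT_comp.
  by move=> z; exact: g0.
have -> : integrate_out muU v g = match v with
  | VU => fun w => \int[muU]_t g (t, w.1.1.1.2, w.1.1.2, w.1.2, w.2)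
  | VA0 => fun w => \int[lambda]_t g (w.1.1.1.1, t, w.1.1.2, w.1.2, w.2)
  | VL => fun w =>
      \int[@counting bool R]_t g (w.1.1.1.1, w.1.1.1.2, t, w.1.2, w.2)
  | VA1 => fun w =>
      \int[lambda]_t g (w.1.1.1.1, w.1.1.1.2, w.1.1.2, t, w.2)
  | VY => fun w =>
      \int[lambda]_t g (w.1.1.1.1, w.1.1.1.2, w.1.1.2, w.1.2, t)
  end%E by apply/funext => -[[[[u a0] l] a1] y]; case: v.
case: v.
- apply: (aux _ _ muU
    (fun z => (z.2, z.1.1.1.1.2, z.1.1.1.2, z.1.1.2, z.1.2))).
  measurable_tuple.
- apply: (aux _ _ lambda
    (fun z => (z.1.1.1.1.1, z.2, z.1.1.1.2, z.1.1.2, z.1.2))).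
  measurable_tuple.
- apply: (aux _ _ (@counting bool R)
    (fun z => (z.1.1.1.1.1, z.1.1.1.1.2, z.2, z.1.1.2, z.1.2))).
  measurable_tuple.
- apply: (aux _ _ lambda
    (fun z => (z.1.1.1.1.1, z.1.1.1.1.2, z.1.1.1.2, z.2, z.1.2))).
  measurable_tuple.
- apply: (aux _ _ lambda
    (fun z => (z.1.1.1.1.1, z.1.1.1.1.2, z.1.1.1.2, z.1.1.2, z.2))).
  measurable_tuple.
Qed.

(** Tonelli's theorem in two coordinates, the other three being frozen. *)
Lemma integrate_outC v1 v2 g : measurable_fun setT g ->
  (forall w, 0 <= g w)%E ->
  integrate_out muU v1 (integrate_out muU v2 g) =
  integrate_out muU v2 (integrate_out muU v1 g).
Proof.
move=> mg g0.
(* The numbering of the vertices breaks the symmetry in [v1] and [v2]; ten pairs remain. *)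
wlog lt12 : v1 v2 / (nat_of_vertex v1 < nat_of_vertex v2)%N.
  move=> C; have [/C//|/C->//|] := ltngtP (nat_of_vertex v1) (nat_of_vertex v2).
  by move/(can_inj nat_of_vertexK) ->.
apply/funext => -[[[[u a0] l] a1] y].
have aux d1 d2 (T1 : measurableType d1) (T2 : measurableType d2)
    (mu1 : {sigma_finite_measure set T1 -> \bar R})
    (mu2 : {sigma_finite_measure set T2 -> \bar R})
    (c : T1 * T2 -> config R) : measurable_fun setT c ->
    (\int[mu1]_s \int[mu2]_t g (c (s, t)) =
     \int[mu2]_t \int[mu1]_s g (c (s, t)))%E.
  move=> mc; apply: (@fubini_tonelli _ _ _ _ R mu1 mu2 (g \o c)).
    exact: measurableT_comp.
  by move=> z; exact: g0.
case: v1 lt12; case: v2 => lt12; try discriminate lt12.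
- apply: (aux _ _ _ _ muU lambda (fun z => (z.1, z.2, l, a1, y))).
  measurable_tuple.
- apply: (aux _ _ _ _ muU (@counting bool R) (fun z => (z.1, a0, z.2, a1, y))).
  measurable_tuple.
- apply: (aux _ _ _ _ muU lambda (fun z => (z.1, a0, l, z.2, y))).
  measurable_tuple.
- apply: (aux _ _ _ _ muU lambda (fun z => (z.1, a0, l, a1, z.2))).
  measurable_tuple.
- apply: (aux _ _ _ _ lambda (@counting bool R) (fun z => (u, z.1, z.2, a1, y))).
  measurable_tuple.
- apply: (aux _ _ _ _ lambda lambda (fun z => (u, z.1, l, z.2, y))).
  measurable_tuple.
- apply: (aux _ _ _ _ lambda lambda (fun z => (u, z.1, l, a1, z.2))).
  measurable_tuple.
- apply: (aux _ _ _ _ (@counting bool R) lambda (fun z => (u, a0, z.1, z.2, y))).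
  measurable_tuple.
- apply: (aux _ _ _ _ (@counting bool R) lambda (fun z => (u, a0, z.1, a1, z.2))).
  measurable_tuple.
- apply: (aux _ _ _ _ lambda lambda (fun z => (u, a0, l, z.1, z.2))).
  measurable_tuple.
Qed.

End IntegrateOut.

Section Marginals.
Context (R : realType).
Variable muU : {sigma_finite_measure set (measurableTypeR R) -> \bar R}.
Implicit Types (g : config R -> \bar R) (v : vertex) (S : {set vertex}).

Lemma foldr_integrate_out_ge0 g (s : seq vertex) : (forall w, 0 <= g w)%E ->
  (forall w, 0 <= foldr (integrate_out muU) g s w)%E.
Proof. by move=> g0; elim: s => [|v s IHs] //; exact: integrate_out_ge0. Qed.

Lemma measurable_foldr_integrate_out g (s : seq vertex) :
  measurable_fun setT g -> (forall w, 0 <= g w)%E ->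
  measurable_fun setT (foldr (integrate_out muU) g s).
Proof.
move=> mg g0; elim: s => [|v s IHs] //; apply: measurable_integrate_out => //.
exact: foldr_integrate_out_ge0.
Qed.

Lemma perm_foldr_integrate_out g (s t : seq vertex) :
  measurable_fun setT g -> (forall w, 0 <= g w)%E -> perm_eq s t ->
  foldr (integrate_out muU) g s = foldr (integrate_out muU) g t.
Proof.
move=> mg g0; elim: s t => [|v s IHs] t.
  by move/perm_size/esym/size0nil => ->.
move=> st; have vt : v \in t by rewrite -(perm_mem st) mem_head.
case/splitPr: vt st => t1 t2 st.
have {}st : perm_eq s (t1 ++ t2).
  rewrite -(perm_cons v); apply: perm_trans st _.
  exact: (permEl (perm_catCA t1 [:: v] t2)).
rewrite /= (IHs _ st); elim: t1 {st} => //= v1 t1 <-.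
by apply: integrate_outC; [exact: measurable_foldr_integrate_out
  |exact: foldr_integrate_out_ge0].
Qed.

Variable f : config R -> R.
Hypotheses (mf : measurable_fun setT f) (f0 : forall w, 0 <= f w).

Let mEf : measurable_fun setT (EFin \o f).
Proof. exact: measurableT_comp. Qed.

Let Ef0 w : (0 <= (EFin \o f) w)%E.
Proof. by rewrite lee_fin. Qed.

(** Makes the order of integration free: the head of [s] is the outermost integral, so a suitable
    order displays one marginal as an integral of another. *)
Lemma marginal_perm S (s : seq vertex) : uniq s -> s =i (~: S)%SET ->
  marginal muU f S = foldr (integrate_out muU) (EFin \o f) s.
Proof.
move=> us sS; apply: perm_foldr_integrate_out => //.
by apply: uniq_perm => //; [exact: enum_uniq|move=> v; rewrite mem_enum sS].
Qed.

Let lambda : {sigma_finite_measure set (measurableTypeR R) -> \bar R} :=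
  @lebesgue_measure R.

Definition plane_A0_Y (w : config R) : measurableTypeR R * measurableTypeR R :=
  (w.1.1.1.2, w.2).

(* A marginal density ignores the coordinates it integrates out, here filled
   with 0 and false. *)
Definition density_A0_Y (z : measurableTypeR R * measurableTypeR R) : \bar R :=
  marginal muU f [set VY; VA0]%SET (0, z.1, false, 0, z.2).

Definition density_A0_L_Y (l : bool)
    (z : measurableTypeR R * measurableTypeR R) : \bar R :=
  marginal muU f [set VY; VA0; VL]%SET (0, z.1, l, 0, z.2).

Local Open Scope ereal_scope.

Lemma density_A0_L_Y_ge0 l z : 0 <= density_A0_L_Y l z.
Proof. exact: foldr_integrate_out_ge0. Qed.

Lemma density_A0_Y_ge0 z : 0 <= density_A0_Y z.
Proof. exact: foldr_integrate_out_ge0. Qed.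

Lemma measurable_density_A0_L_Y l : measurable_fun setT (density_A0_L_Y l).
Proof.
apply: (measurableT_comp (measurable_foldr_integrate_out _ mEf Ef0)).
measurable_tuple.
Qed.

Lemma measurable_density_A0_Y : measurable_fun setT density_A0_Y.
Proof.
apply: (measurableT_comp (measurable_foldr_integrate_out _ mEf Ef0)).
measurable_tuple.
Qed.

Ltac marginal_order s :=
  rewrite (@marginal_perm _ s) //; last by case; rewrite !inE.

Lemma marginal_YA0E w :
  marginal muU f [set VY; VA0]%SET w = density_A0_Y (plane_A0_Y w).
Proof.
rewrite /density_A0_Y; marginal_order [:: VU; VL; VA1].
by move: w => [[[[u a0] l] a1] y].
Qed.

Lemma marginal_A0E w : marginal muU f [set VA0]%SET w =
  \int[lambda]_y density_A0_Y (w.1.1.1.2, y).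
Proof.
(* With [VY] at the head, the tail is the order chosen next for [density_A0_Y], and the two sides
   agree by computation. *)
rewrite /density_A0_Y; marginal_order [:: VY; VU; VL; VA1].
marginal_order [:: VU; VL; VA1].
by move: w => [[[[u a0] l] a1] y].
Qed.

Lemma marginal_YE w : marginal muU f [set VY]%SET w =
  \int[lambda]_a0 density_A0_Y (a0, w.2).
Proof.
rewrite /density_A0_Y; marginal_order [:: VA0; VU; VL; VA1].
marginal_order [:: VU; VL; VA1].
by move: w => [[[[u a0] l] a1] y].
Qed.

Lemma marginal0E w : marginal muU f finset.set0 w =
  \int[lambda]_a0 \int[lambda]_y density_A0_Y (a0, y).
Proof.
rewrite /density_A0_Y; marginal_order [:: VA0; VY; VU; VL; VA1].
marginal_order [:: VU; VL; VA1].
by move: w => [[[[u a0] l] a1] y].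
Qed.

Lemma marginal_YA0LE w l : marginal muU f [set VY; VA0; VL]%SET (set_L w l) =
  density_A0_L_Y l (plane_A0_Y w).
Proof.
rewrite /density_A0_L_Y; marginal_order [:: VU; VA1].
by move: w => [[[[u a0] l'] a1] y].
Qed.

Lemma marginal_A0LE w l : marginal muU f [set VA0; VL]%SET (set_L w l) =
  \int[lambda]_y density_A0_L_Y l (w.1.1.1.2, y).
Proof.
rewrite /density_A0_L_Y; marginal_order [:: VY; VU; VA1].
marginal_order [:: VU; VA1].
by move: w => [[[[u a0] l'] a1] y].
Qed.

Lemma density_A0_YE z :
  density_A0_Y z = density_A0_L_Y true z + density_A0_L_Y false z.
Proof.
rewrite /density_A0_Y; marginal_order [:: VL; VU; VA1].
rewrite -(@integral_counting_bool _ (density_A0_L_Y ^~ z)); last first.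
  by move=> b; exact: density_A0_L_Y_ge0.
by rewrite /density_A0_L_Y; marginal_order [:: VU; VA1].
Qed.

(** Partial products of the left-nested base measure, packed as sigma-finite so that Tonelli's
    theorem can peel off the last factor. *)
Let base2 := sigma_finite_product muU lambda.
Let base3 := sigma_finite_product base2 (@counting bool R).
Let base4 := sigma_finite_product base3 lambda.

(** The marginal over the empty index set integrates everything out, so it is the total mass, by
    Tonelli's theorem from the last factor inwards. *)
Lemma integral_base_measure w :
  \int[base_measure muU]_w (f w)%:E = marginal muU f finset.set0 w.
Proof.
pose F1 := fubini_F lambda (EFin \o f).
pose F2 := fubini_F lambda F1.
pose F3 := fubini_F (@counting bool R) F2.
have F10 x : 0 <= F1 x by exact: integral_ge0.
have F20 x : 0 <= F2 x by exact: integral_ge0.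
have F30 x : 0 <= F3 x by exact: integral_ge0.
have mF1 : measurable_fun setT F1 by exact: measurable_fun_fubini_tonelli_F.
have mF2 : measurable_fun setT F2 by exact: measurable_fun_fubini_tonelli_F.
have mF3 : measurable_fun setT F3 by exact: measurable_fun_fubini_tonelli_F.
rewrite (@marginal_perm _ [:: VU; VA0; VL; VA1; VY]) //; last first.
  by case; rewrite !inE.
rewrite (@fubini_tonelli1 _ _ _ _ _ base4 lambda (EFin \o f)) //.
rewrite (@fubini_tonelli1 _ _ _ _ _ base3 lambda F1) //.
rewrite (@fubini_tonelli1 _ _ _ _ _ base2 (@counting bool R) F2) //.
rewrite (@fubini_tonelli1 _ _ _ _ _ muU lambda F3) //.
by move: w => [[[[u a0] l'] a1] y].
Qed.

Lemma ae_base_of_plane (Q : (measurableTypeR R * measurableTypeR R)%type -> Prop) :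
  {ae (lambda \x lambda), forall z, Q z} ->
  {ae base_measure muU, forall w, Q (plane_A0_Y w)}.
Proof.
move=> [N [mN N0 QN]].
(* [Q] may fail to be measurable, so it is replaced by the complement of a measurable null set that
   contains its failures. *)
have aeN : {ae (lambda \x lambda), forall z, (~` N) z}.
  by exists N; split => //; rewrite setCK.
suff : {ae base_measure muU, forall w, (~` N) (plane_A0_Y w)}.
  by apply: filterS => w Nw; apply: contrapT => /QN.
apply: (@ysection_ae_product _ _ _ _ _ base4 lambda).
  have mplane : measurable_fun setT plane_A0_Y.
    by rewrite /plane_A0_Y; measurable_tuple.
  rewrite -[X in measurable X]setTI.
  by apply: (mplane measurableT); exact: measurableC.
have := ae_product_ysection aeN; apply: filterS => y Hy.
apply: (@ae_product_fst _ _ _ _ _ base3 lambda (fun w => ~ N (w.1.2, y))).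
apply: (@ae_product_fst _ _ _ _ _ _ (@counting bool R) (fun w => ~ N (w.2, y))).
exact: (@ae_product_snd _ _ _ _ _ muU lambda (fun a => ~ N (a, y))).
Qed.

(** [Q] does not see [u], [l] and [a1], which are frozen at suitable values; these exist since every
    factor has non-zero mass. The conclusion stays iterated, as in the hypothesis of
    [density_factorization], because [Q] will involve an arbitrary function [h]. *)
Lemma ae_plane_of_base (Q : (measurableTypeR R * measurableTypeR R)%type -> Prop) :
  muU setT != 0 ->
  {ae base_measure muU, forall w, Q (plane_A0_Y w)} ->
  {ae lambda, forall y, {ae lambda, forall a0, Q (a0, y)}}.
Proof.
move=> muU0 /(@ae_product_ysection _ _ _ _ _ base4 lambda).
have lambda0 : lambda setT != 0.
  have -> : lambda setT = +oo; last by [].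
  rewrite -(set_itvNyy R); apply: etrans (lebesgue_measure_itv _) _.
  by rewrite ltNye.
have count0 : @counting bool R setT != 0.
  have := @integral_counting_bool R (cst 1) (fun=> lee01).
  by rewrite integral_cst// mul1e => ->.
apply: filterS => y /(@ae_product_ysection _ _ _ _ _ base3 lambda).
case/(ae_witness lambda0) => a1 /(@ae_product_ysection _ _ _ _ _ _ (@counting bool R)).
case/(ae_witness count0) => l /(@ae_product_xsection _ _ _ _ _ muU lambda).
by case/(ae_witness muU0) => u.
Qed.

End Marginals.

(** * The g-formula *)

Section GFormula.
Context (R : realType).
Variable muU : {sigma_finite_measure set (measurableTypeR R) -> \bar R}.
Variable f : config R -> R.
Hypotheses (mf : measurable_fun setT f) (f0 : forall w, 0 <= f w).
Hypothesis f1 : (\int[base_measure muU]_w (f w)%:E = 1)%E.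

Let lambda : {sigma_finite_measure set (measurableTypeR R) -> \bar R} :=
  @lebesgue_measure R.
(** In the usual notation, [r] is f(a0, y), [p l] is f(a0, l, y), [s] is f(a0) and [q l] is f(a0,
    l). *)
Let r := density_A0_Y muU f.
Let p := density_A0_L_Y muU f.
Let s a := (\int[lambda]_y r (a, y))%E.
Let q l a := (\int[lambda]_y p l (a, y))%E.

Let mr : measurable_fun setT r.
Proof. exact: measurable_density_A0_Y. Qed.

Let r0 z : (0 <= r z)%E.
Proof. exact: density_A0_Y_ge0. Qed.

Let mp l : measurable_fun setT (p l).
Proof. exact: measurable_density_A0_L_Y. Qed.

Let p0 l z : (0 <= p l z)%E.
Proof. exact: density_A0_L_Y_ge0. Qed.

Let rE z : r z = (p true z + p false z)%E.
Proof. exact: density_A0_YE. Qed.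

Let sE a : s a = (q true a + q false a)%E.
Proof.
rewrite /s -ge0_integralD//.
- by apply: eq_integral => y _; exact: rE.
- exact: measurable_fun_pair2.
- exact: measurable_fun_pair2.
Qed.

Let r1 : (\int[lambda]_a \int[lambda]_y r (a, y) = 1)%E.
Proof.
(* The configuration is arbitrary: the marginal over the empty index set is constant. *)
rewrite -f1 (integral_base_measure muU mf f0 (0, 0, false, 0, 0)).
by rewrite marginal0E.
Qed.

Let ae_r_lty : {ae (lambda \x lambda)%E, forall z, (r z < +oo)%E}.
Proof. exact: ae_density_lty. Qed.

Let ae_s_lty : {ae (lambda \x lambda)%E, forall z, (s z.1 < +oo)%E}.
Proof.
apply: (@ae_product_fst _ _ _ _ _ _ _ (fun a => s a < +oo)%E).
exact: ae_marginal1_lty.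
Qed.

Let ae_t_lty :
  {ae (lambda \x lambda)%E, forall z, (\int[lambda]_a r (a, z.2) < +oo)%E}.
Proof.
apply: (@ae_product_snd _ _ _ _ _ _ _
  (fun y => \int[lambda]_a r (a, y) < +oo)%E).
exact: ae_marginal2_lty.
Qed.

(** With U integrated outermost, a zero measure [muU] would give total mass 0 instead of 1. *)
Lemma muU_neq0 : muU setT != 0%E.
Proof.
apply/eqP => muU0; have := integral_base_measure muU mf f0 (0, 0, false, 0, 0).
rewrite (@marginal_perm _ _ _ mf f0 _ [:: VU; VA0; VL; VA1; VY]) //=; last first.
  by case; rewrite !inE.
rewrite f1 null_set_integral//; first by move/eqP; rewrite onee_eq0.
have mEf : measurable_fun setT (EFin \o f) by exact: measurableT_comp.
have Ef0 w : (0 <= (EFin \o f) w)%E by rewrite lee_fin.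
have mc : measurable_fun setT
    (fun u : measurableTypeR R => (u, 0, false, 0, 0) : config R).
  measurable_tuple.
exact: (measurableT_comp (measurable_foldr_integrate_out muU
  [:: VA0; VL; VA1; VY] mEf Ef0) mc).
Qed.

(** The chain rule f(y | a0, l) f(l | a0) = f(y, l | a0), summed over l. *)
Lemma g_formulaE : {ae base_measure muU, forall w,
  (0 < marginal muU f [set VA0]%SET w)%E ->
  g_formula muU f w = cond_density muU f [set VY]%SET [set VA0]%SET w}.
Proof.
suff : {ae base_measure muU, forall w, (0 < s (plane_A0_Y w).1)%E ->
    \sum_(l : bool) fine (p l (plane_A0_Y w)) / fine (q l (plane_A0_Y w).1) *
      (fine (q l (plane_A0_Y w).1) / fine (s (plane_A0_Y w).1)) =
    fine (r (plane_A0_Y w)) / fine (s (plane_A0_Y w).1)}.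
  apply: filterS => w H.
  rewrite /g_formula /cond_density (finset.setUC [set VL]%SET) finset.setUA.
  have sL l : marginal muU f [set VA0]%SET (set_L w l) = s (plane_A0_Y w).1.
    by rewrite marginal_A0E//; move: w {H} => [[[[u a0] l'] a1] y].
  under eq_bigr do rewrite marginal_YA0LE// !marginal_A0LE// sL.
  by rewrite marginal_YA0E// marginal_A0E.
apply: (@ae_base_of_plane _ muU (fun z => (0 < s z.1)%E ->
    \sum_(l : bool) fine (p l z) / fine (q l z.1) *
      (fine (q l z.1) / fine (s z.1)) = fine (r z) / fine (s z.1))).
have ae0 l := ae_eq0_of_marginal_eq0 lambda lambda (@mp l) (@p0 l).
apply: filterS3 (ae0 true) (ae0 false) (filterI ae_r_lty ae_s_lty) => z pt pf [rz sz] s0.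
rewrite big_bool/=.
(* [p l] and [q l] are bounded by [r] and [s], which are finite almost everywhere; hence [fine]
   respects the sum. *)
have fin l : p l z \is a fin_num.
  rewrite ge0_fin_numE//; apply: le_lt_trans rz; rewrite rE.
  by case: l; [rewrite leeDl|rewrite leeDr].
have q0 l a : (0 <= q l a)%E by exact: integral_ge0.
have finq l : q l z.1 \is a fin_num.
  rewrite ge0_fin_numE//; apply: le_lt_trans sz; rewrite sE.
  by case: l; [rewrite leeDl|rewrite leeDr].
(* If [q l z.1 = 0], the left side is 0 by the convention on division, and the right side is 0
   because [p l z] vanishes too. *)
have cancel l : fine (p l z) / fine (q l z.1) * (fine (q l z.1) / fine (s z.1))
    = fine (p l z) / fine (s z.1).
  have [ql0|ql0] := eqVneq (q l z.1) 0%E.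
    have -> : p l z = 0%E by case: l ql0 {fin finq}; [exact: pt|exact: pf].
    by rewrite !mul0r.
  by rewrite mulrA divfK// fine_eq0.
by rewrite !cancel -mulrDl -fineD// rE.
Qed.

(** By [g_formulaE] the sum is f(y | a0). If this is some [h y], the density of (A0, Y) factors into
    its marginals, which forces f(y | a0) = f(y). *)
Lemma g_formula_free_of_A0P : g_formula_free_of_A0 muU f <->
  cond_indep muU f [set VY]%SET [set VA0]%SET finset.set0.
Proof.
rewrite /cond_indep finset.setU0; split; last first.
  (* The witness is the marginal density of Y; the other coordinates are placeholders. *)
  move=> H; exists (fun y =>
    cond_density muU f [set VY]%SET finset.set0 (0, 0, false, 0, y)).
  apply: filterS2 g_formulaE H => w gE H A0; rewrite gE// H//.
  rewrite /cond_density finset.setU0 !marginal_YE// !marginal0E//.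
  by move: w {gE H A0} => [[[[u a0] l'] a1] y].
move=> [h hE].
have hE' : {ae lambda, forall y, {ae lambda, forall a, (0 < s a)%E ->
    fine (r (a, y)) / fine (s a) = h y}}.
  apply: (@ae_plane_of_base _ muU (fun z => (0 < s z.1)%E ->
    fine (r z) / fine (s z.1) = h z.2) muU_neq0).
  apply: filterS2 g_formulaE hE => w gE hw.
  have -> : (plane_A0_Y w).2 = val_Y w by case: w {gE hw} => [[[[? ?] ?] ?] ?].
  move: hw gE; rewrite /cond_density marginal_YA0E// marginal_A0E//.
  by move=> + + s0 => /(_ s0) <- /(_ s0) ->.
(* The conditioning set is empty and has density 1, so the target is f(y | a0) = f(y) where f(a0) >
   0. *)
suff : {ae base_measure muU, forall w, (0 < s (plane_A0_Y w).1)%E ->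
    fine (r (plane_A0_Y w)) / fine (s (plane_A0_Y w).1) =
    fine (\int[lambda]_a r (a, (plane_A0_Y w).2))}.
  apply: filterS => w H.
  have m0 : marginal muU f finset.set0 w = 1%E by rewrite marginal0E.
  rewrite /cond_density finset.setU0 m0 divr1.
  by rewrite marginal_YA0E// marginal_A0E// marginal_YE.
apply: (@ae_base_of_plane _ muU (fun z => (0 < s z.1)%E ->
    fine (r z) / fine (s z.1) = fine (\int[lambda]_a r (a, z.2)))).
have rE' := density_factorization mr r0 r1 hE'.
apply: filterS3 ae_s_lty ae_t_lty rE' => z sz tz -> s0.
have sf : s z.1 \is a fin_num by rewrite ge0_fin_numE// ltW.
have tf : (\int[lambda]_a r (a, z.2))%E \is a fin_num.
  by rewrite ge0_fin_numE//; exact: integral_ge0.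
by rewrite fineM// mulrC mulKf// gt_eqF// fine_gt0// s0.
Qed.

End GFormula.

(** * Reduction to d-separation and comparison graph by graph *)

Theorem theorem1 (R : realType) (d : measure_display) (Omega : measurableType d)
    (P : probability Omega R)
    (U A0 : {RV P >-> R}) (L : {RV P >-> bool}) (A1 Y : {RV P >-> R})
    (muU : {sigma_finite_measure set (measurableTypeR R) -> \bar R})
    (hmuU : lebesgue_or_counting muU)
    (f : config R -> R)
    (hf : joint_density muU P U A0 L A1 Y f)
    (hfaithful : faithful muU f dag_1a \/ faithful muU f dag_1b \/
                 faithful muU f dag_1c \/ faithful muU f dag_1d) :
  cond_indep muU f [set VA0; VA1]%SET [set VY]%SET [set VL; VU]%SET <->
  (cond_indep muU f [set VY]%SET [set VA1]%SET [set VA0; VL]%SET /\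
   g_formula_free_of_A0 muU f).
Proof.
case: hf => mf f0 fP.
have f1 : (\int[base_measure muU]_w (f w)%:E = 1)%E.
  by rewrite -fP// preimage_setT probability_setT.
rewrite (g_formula_free_of_A0P mf f0 f1).
have null_faithful e : faithful muU f e ->
    cond_indep muU f [set VA0; VA1]%SET [set VY]%SET [set VL; VU]%SET <->
    d_separated e [set VA0; VA1]%SET [set VY]%SET [set VL; VU]%SET.
  by apply; rewrite finset.disjoints_subset; apply/fintype.subsetP => -[]; rewrite !inE.
have A1_faithful e : faithful muU f e ->
    cond_indep muU f [set VY]%SET [set VA1]%SET [set VA0; VL]%SET <->
    d_separated e [set VY]%SET [set VA1]%SET [set VA0; VL]%SET.
  by apply; rewrite finset.disjoints_subset; apply/fintype.subsetP => -[]; rewrite !inE.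
have A0_faithful e : faithful muU f e ->
    cond_indep muU f [set VY]%SET [set VA0]%SET finset.set0 <->
    d_separated e [set VY]%SET [set VA0]%SET finset.set0.
  by apply; rewrite finset.disjoints_subset; apply/fintype.subsetP => -[]; rewrite !inE.
have null_edge (e : rel vertex) : e VA0 VY || e VA1 VY ->
    ~ d_separated e [set VA0; VA1]%SET [set VY]%SET [set VL; VU]%SET.
  by case/orP => eY; [apply: (edge_not_d_separated (x := VA0) (y := VY))
    |apply: (edge_not_d_separated (x := VA1) (y := VY))];
    rewrite ?inE// /Defs.adjacent eY.
have A_edge (e : rel vertex) (v : vertex) (D : {set vertex}) : v != VY -> e v VY ->
    ~ d_separated e [set VY]%SET [set v]%SET D.
  move=> vY eY; apply: (edge_not_d_separated (x := VY) (y := v));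
    by rewrite ?inE// ?(eq_sym VY)// /Defs.adjacent eY orbT.
(* Both sides are true in DAG 1b, and both are false in the three other graphs. *)
case: hfaithful => [|[|[|]]] hG; rewrite (null_faithful _ hG)
  (A1_faithful _ hG) (A0_faithful _ hG).
- by split=> [/null_edge|[/A_edge]] C; case: C.
- split=> _; last exact: d_separated_1b_null.
  by split; [exact: d_separated_1b_Y_A1|exact: d_separated_1b_Y_A0].
- by split=> [/null_edge|[/A_edge]] C; case: C.
- by split=> [/null_edge|[_ /A_edge]] C; case: C.
Qed.
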